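(* Let $0<\delta<1$ and $w>e$, and let the number of samples $K\in\mathbb{N}$ satisfy $$K\ \geq\ \max\left\{\frac{2\log(2\,\#\mathcal{P})+2\log(\delta^{-1})}{\log(w/e)},\ 3\right\}.$$ Then $$\mathbb{P}\Big\{ w^{-1}\Delta^{\mathrm{rel}}(\mu)\leq \frac{\|u(\mu)-\widetilde u(\mu)\|_\Sigma}{\|u(\mu)\|_\Sigma}\leq w\,\Delta^{\mathrm{rel}}(\mu)\ \text{ for all } \mu\in\mathcal{P}\Big\}\geq 1-\delta,$$ and also $$\mathbb{P}\Bigg\{ w^{-1}\Delta^{\mathrm{rel}}\leq \frac{\sqrt{\tfrac{1}{\#\mathcal{P}}\sum_{\mu\in\mathcal{P}}\|u(\mu)-\widetilde u(\mu)\|_\Sigma^2}}{\sqrt{\tfrac{1}{\#\mathcal{P}}\sum_{\mu\in\mathcal{P}}\|u(\mu)\|_\Sigma^2}}\leq w\,\Delta^{\mathrm{rel}}\Bigg\}\geq 1-\delta .$$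
   Context: Setting. $\mathcal{P}=\mathcal{P}_1\times\cdots\times\mathcal{P}_p\subset\mathbb{R}^p$ is a nonempty finite parameter set (each $\mathcal{P}_i\subset\mathbb{R}$ finite), with cardinality $\#\mathcal{P}$. For each $\mu=(\mu_1,\dots,\mu_p)\in\mathcal{P}$, $A(\mu)\in\mathbb{R}^{N\times N}$ is an invertible matrix, $f(\mu)\in\mathbb{R}^N$, and $u(\mu)\in\mathbb{R}^N$ is the solution of $A(\mu)u(\mu)=f(\mu)$. An approximation of $u$ is a given deterministic function $\widetilde u:\mathcal{P}\to\mathbb{R}^N$ of the separated form $\widetilde u(\mu)=\sum_{m=1}^M u^m_{\mathcal X}\,u^m_1(\mu_1)\cdots u^m_p(\mu_p)$ with $u^m_{\mathcal X}\in\mathbb{R}^N$ and $u^m_i:\mathcal{P}_i\to\mathbb{R}$. The residual is $r(\mu)=f(\mu)-A(\mu)\widetilde u(\mu)$. $\Sigma\in\mathbb{R}^{N\times N}$ is a symmetric positive semi-definite matrix and $\|v\|_\Sigma=\sqrt{v^T\Sigma v}$ is the associated semi-norm. It is assumed that $\|u(\mu)\|_\Sigma\neq0$ for all $\mu\in\mathcal{P}$, so that the relative errors are defined. $Z_1,\dots,Z_K$ are independent Gaussian random vectors in $\mathbb{R}^N$ with mean zero and covariance $\Sigma$ (possibly singular). $Y_i(\mu)\in\mathbb{R}^N$ denotes the solution of the random dual problem $A(\mu)^TY_i(\mu)=Z_i$, $1\leq i\leq K$; thus $Y_i(\mu)^Tr(\mu)=Z_i^T(u(\mu)-\widetilde u(\mu))$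 and $Y_i(\mu)^Tf(\mu)=Z_i^Tu(\mu)$. Relative error estimators (defined almost surely): $$\Delta^{\mathrm{rel}}(\mu)=\sqrt{\frac{\frac1K\sum_{i=1}^K(Y_i(\mu)^Tr(\mu))^2}{\frac1K\sum_{i=1}^K(Y_i(\mu)^Tf(\mu))^2}},\qquad \Delta^{\mathrm{rel}}=\sqrt{\frac{\frac{1}{K\#\mathcal{P}}\sum_{\mu\in\mathcal{P}}\sum_{i=1}^K(Y_i(\mu)^Tr(\mu))^2}{\frac{1}{K\#\mathcal{P}}\sum_{\mu\in\mathcal{P}}\sum_{i=1}^K(Y_i(\mu)^Tf(\mu))^2}}.$$ $\log$ is the natural logarithm and $e=\exp(1)$. *)

(* Defs.v *)
From HB Require Import structures.
From mathcomp Require Import all_boot all_order all_algebra finmap.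
From mathcomp Require Import all_classical all_reals all_analysis.

Set Implicit Arguments.
Unset Strict Implicit.
Unset Printing Implicit Defensive.

Import Order.TTheory GRing.Theory Num.Theory.

Local Open Scope classical_set_scope.
Local Open Scope ring_scope.

Definition dotv (R : pzRingType) (N : nat) (a b : 'cV[R]_N) : R :=
  (a^T *m b) ord0 ord0.

Definition sym_psd (R : numDomainType) (N : nat) (S : 'M[R]_N) : Prop :=
  S^T = S /\ forall v : 'cV[R]_N, 0 <= dotv v (S *m v).

Definition seminorm_mx (R : rcfType) (N : nat) (S : 'M[R]_N) (v : 'cV[R]_N) : R :=
  Num.sqrt (dotv v (S *m v)).

(* The product set P_1 x ... x P_p: the i-th coordinate of mu is mu i : Ps i,
   whose underlying real number is val (mu i). *)
Definition param (R : realType) (p : nat) (Ps : 'I_p -> {fset R}) : finType :=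
  {dffun forall i : 'I_p, Ps i}.

Definition separated_form (R : realType) (N p : nat) (Ps : 'I_p -> {fset R})
    (ut : param Ps -> 'cV[R]_N) : Prop :=
  exists (M : nat) (uX : 'I_M -> 'cV[R]_N)
    (uc : 'I_M -> forall i : 'I_p, Ps i -> R),
    forall mu : param Ps,
      ut mu = \sum_(m < M) (\prod_(i < p) uc m i (mu i)) *: uX m.

Section random_vectors.
Context (R : realType) (d : measure_display) (T : measurableType d).
Variable P : probability T R.

(* Random vectors of R^N are measurable maps to N.-tuple R, which carries the
   product (Borel) sigma-algebra; colv gives the corresponding column vector. *)
Definition colv (N : nat) (t : N.-tuple R) : 'cV[R]_N := \col_i tnth t i.

(* Law N(m, s^2); s = 0 is treated apart because normal_prob m 0 is by
   convention the uniform law on [0, 1], not the Dirac mass at m. *)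
Definition gaussian_law (m s : R) (B : set R) : \bar R :=
  if s == 0 then \d_m B else normal_prob m s B.

Definition gaussian_vector (N : nat) (X : {RV P >-> N.-tuple R}) : Prop :=
  forall a : 'cV[R]_N, exists m s : R, forall B : set R, measurable B ->
    P ((fun om => dotv a (colv (X om))) @^-1` B) = gaussian_law m s B.

Definition has_mean (N : nat) (X : {RV P >-> N.-tuple R}) (b : 'cV[R]_N) : Prop :=
  forall i : 'I_N, ('E_P[fun om => tnth (X om) i] = (b i ord0)%:E)%E.

Definition has_covariance (N : nat) (X : {RV P >-> N.-tuple R}) (S : 'M[R]_N)
    : Prop :=
  forall i j : 'I_N,
    covariance P (fun om => tnth (X om) i) (fun om => tnth (X om) j)
      = (S i j)%:E.

Definition mutually_independent (I : finType) (d' : measure_display)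
    (T' : measurableType d') (X : I -> {RV P >-> T'}) : Prop :=
  forall (J : {set I}) (B : I -> set T'), (forall i, measurable (B i)) ->
    P (\bigcap_(i in [set` J]) (X i @^-1` B i))
      = (\prod_(i in J) P (X i @^-1` B i))%E.

End random_vectors.

Section estimators.
Context (R : realType) (N K : nat) (X : finType) (T : Type).
Variables (Y : 'I_K -> X -> T -> 'cV[R]_N) (r f : X -> 'cV[R]_N).

(* Estimators that are only almost surely defined become total functions by the
   convention x / 0 = 0. *)
Definition rel_est (mu : X) (om : T) : R :=
  Num.sqrt ((K%:R^-1 * \sum_(i < K) dotv (Y i mu om) (r mu) ^+ 2)
          / (K%:R^-1 * \sum_(i < K) dotv (Y i mu om) (f mu) ^+ 2)).

Definition rel_est_global (om : T) : R :=
  Num.sqrt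
    (((K * #|X|)%:R^-1
        * \sum_(mu : X) \sum_(i < K) dotv (Y i mu om) (r mu) ^+ 2)
   / ((K * #|X|)%:R^-1
        * \sum_(mu : X) \sum_(i < K) dotv (Y i mu om) (f mu) ^+ 2)).

End estimators.

(* Main.v *)
Require Import Defs.
From HB Require Import structures.
From mathcomp Require Import all_boot all_order all_algebra finmap.
From mathcomp Require Import all_classical all_reals all_analysis.
From mathcomp Require Import measurable_realfun ring lra.

(* Since A(mu)^T Y_i = Z_i, the estimators are ratios of sums of squares of the
   Gaussian variables Z_i^T v with v = u(mu) - ut(mu) (numerator) and v = u(mu)
   (denominator). For a fixed v with |v|^2 = v^T S v, the Chernoff bound with
   E exp(t (Z_i^T v)^2) = (1 - 2 t |v|^2)^(-1/2) and independence gives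
   K |v|^2 / w <= sum_i (Z_i^T v)^2 <= w K |v|^2 outside an event of
   probability at most (e/w)^(K/2): the two one-sided tails add up to at most
   this as soon as w >= e and K >= 3. A union bound over the 2 #P vectors v
   leaves probability at least 1 - delta, and on that event both estimates
   follow by dividing the bounds, for each mu or after summation over mu.

   The joint law of (Z_i) enters only through the product formula for
   expectations, and the mean and variance of a normal law are read off its
   exponential moments through 1 + x <= exp x. *)

Import Order.TTheory GRing.Theory Num.Theory.
Import numFieldNormedType.Exports.

Local Open Scope classical_set_scope.
Local Open Scope ring_scope.

(** * Integration against weighted pushforward measures *)

Section density.
Import HBNNSimple.

(** Both sides are monotone limits along simple functions increasing to [g], and for an indicator
    the claim is the hypothesis on [nu]. The weight [W] lets one statement serve for laws ([W = 1]),
    for densities ([X] the identity) and for splitting off one of several independent factors. *)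
Lemma ge0_integral_density {d1 d2} {T1 : measurableType d1}
    {T2 : measurableType d2} {R : realType} (mu : {measure set T1 -> \bar R})
    (nu : {measure set T2 -> \bar R}) (W : T1 -> R) (X : T1 -> T2)
    (g : T2 -> R) :
  measurable_fun setT W -> (forall x, 0 <= W x) -> measurable_fun setT X ->
  (forall B, measurable B ->
    (\int[mu]_(x in X @^-1` B) (W x)%:E = nu B)%E) ->
  measurable_fun setT g -> (forall y, 0 <= g y) ->
  (\int[mu]_x (W x * g (X x))%:E = \int[nu]_y (g y)%:E)%E.
Proof.
move=> mW W0 mX WX mg g0.
have mg' : measurable_fun setT (fun y => (g y)%:E) by exact/measurable_EFinP.
have g0' y : setT y -> (0 <= (g y)%:E)%E by move=> _; rewrite lee_fin.
pose f_ := nnsfun_approx measurableT mg'.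
have fcvg y : ((f_ n y)%:E @[n --> \oo] --> (g y)%:E)%E.
  exact: (cvg_nnsfun_approx measurableT mg' g0').
have mpre B : measurable B -> measurable (X @^-1` B).
  by move=> mB; rewrite -[_ @^-1` _]setTI; exact: mX.
transitivity (limn (fun n => \int[nu]_x (f_ n x)%:E))%E; last first.
  rewrite -monotone_convergence//.
  - by apply: eq_integral => y _; apply/cvg_lim => //; exact: fcvg.
  - by move=> n; exact/measurable_EFinP/measurable_funP.
  - by move=> n y _; rewrite lee_fin.
  - by move=> y _ m n mn; rewrite lee_fin; exact/lefP/nd_nnsfun_approx.
transitivity (limn (fun n => \int[mu]_x (W x * f_ n (X x))%:E))%E.
  rewrite -monotone_convergence//.
  - apply: eq_integral => x _; apply/esym/cvg_lim => //.
    under eq_fun do rewrite EFinM.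
    by rewrite EFinM; apply: cvgeZl => //; exact: fcvg.
  - move=> n; apply/measurable_EFinP; apply: measurable_funM => //.
    by apply: measurableT_comp => //; exact/measurable_funP.
  - by move=> n x _; rewrite lee_fin mulr_ge0.
  - move=> x _ m n mn; rewrite lee_fin ler_wpM2l//.
    exact/lefP/nd_nnsfun_approx.
congr (limn _); apply/funext => n.
transitivity (\sum_(k \in range (f_ n))
    \int[mu]_x (k * (W x * \1_(f_ n @^-1` [set k]) (X x)))%:E)%E.
  rewrite -ge0_integral_fsum//; last 2 first.
  - move=> k; apply/measurable_EFinP; apply: measurable_funM => //.
    apply: measurable_funM => //; apply: measurableT_comp => //.
  - move=> k x _; rewrite lee_fin.
    (* A negative [k] is not a value of the nonnegative function [f_ n], so its level set is
       empty. *)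
    have [k0|k0] := leP 0 k; first by rewrite !mulr_ge0// indicE.
    by rewrite preimage_nnfun0// indicE in_set0 !mulr0.
  apply: eq_integral => x _; rewrite fsumEFin//; congr EFin.
  rewrite fimfunE mulr_fsumr.
  by apply: eq_fsbigr => k _; rewrite mulrCA.
under [RHS]eq_integral do rewrite fimfunE -fsumEFin//.
rewrite [RHS]ge0_integral_fsum//; last 2 first.
- by move=> k; apply/measurable_EFinP; exact: measurable_funM.
- by move=> k y _; rewrite nnfun_muleindic_ge0.
apply: eq_fsbigr => k /set_mem [y _ <-].
set k' := f_ n y; set B := _ @^-1` _.
have mB : measurable B by exact: measurable_funPTI.
under eq_integral do rewrite EFinM.
under [RHS]eq_integral do rewrite EFinM.
rewrite ge0_integralZl//; last 3 first.
- apply/measurable_EFinP; apply: measurable_funM => //.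
  exact: measurableT_comp.
- by move=> x _; rewrite lee_fin mulr_ge0// indicE.
- by rewrite lee_fin.
rewrite ge0_integralZl//; last 2 first.
- exact/measurable_EFinP.
- by rewrite lee_fin.
rewrite integral_indic// setIT -WX//; congr (_ * _)%E.
rewrite [RHS]integral_mkcond; apply: eq_integral => x _.
rewrite patchE indicE (_ : (x \in X @^-1` B) = (X x \in B)); last first.
  by apply/idP/idP; rewrite !inE.
by case: ifPn => _; rewrite ?mulr1 ?mulr0.
Qed.

End density.

(** * Expectation of a product of independent factors *)

Lemma ge0_expectation_prod {d d'} {T : measurableType d}
    {T' : measurableType d'} {R : realType} {P : probability T R} {I : finType}
    (Z : I -> {RV P >-> T'}) (g : I -> T' -> R) :
  mutually_independent Z ->
  (forall i, measurable_fun setT (g i)) -> (forall i y, 0 <= g i y) ->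
  (forall i, \int[P]_x (g i (Z i x))%:E < +oo)%E ->
  (\int[P]_x (\prod_i g i (Z i x))%:E = \prod_i \int[P]_x (g i (Z i x))%:E)%E.
Proof.
move=> Zind mg g0 goo.
(* Starting from indicator functions, where the claim is independence, the
   factors are replaced by the [g i] one index of [s] at a time. *)
suff H (s : seq I) (h : I -> T' -> R) :
    (forall i, i \in s -> h i = g i) ->
    (forall i, i \notin s -> exists2 B, measurable B & h i = \1_B) ->
    (\int[P]_x (\prod_i h i (Z i x))%:E =
      \prod_i \int[P]_x (h i (Z i x))%:E)%E.
  by apply: (H (enum I)) => // i; rewrite mem_enum.
elim: s h => [|j s IHs] h hg hB.
  have {}hB i : exists B, measurable B /\ h i = \1_B.
    by have [B mB ->] := hB i isT; exists B.
  have [B /all_and2[mB hE]] := choice hB.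
  have mZB i : measurable (Z i @^-1` B i) by exact: measurable_funPTI.
  transitivity (\int[P]_x
      (\1_(\bigcap_(i in [set` [set: I]%SET]) Z i @^-1` B i) x : R)%:E)%E.
    apply: eq_integral => x _; congr EFin.
    rewrite indicE; under eq_bigr do rewrite hE indicE.
    case: (boolP (x \in _)) => [/set_mem xB|/negP xB].
      rewrite big1// => i _; rewrite mem_set//.
      by apply: xB; rewrite /= inE.
    apply/eqP/prodf_eq0; apply: contrapT => nB; apply: xB.
    apply/mem_set => i _ /=; apply: contrapT => ZiB; apply: nB.
    by exists i => //; rewrite memNset.
  rewrite integral_indic//; last first.
    by apply: fin_bigcap_measurable => // *; exact: mZB.
  rewrite setIT; etransitivity; first exact: (Zind [set: I]%SET B mB).
  rewrite big_mkcond/=.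
  apply: eq_bigr => i _; rewrite inE hE -[in LHS](setIT (_ @^-1` _)).
  by rewrite -integral_indic.
case: (boolP (j \in s)) => [js|js].
  apply: IHs => i iNs.
    by apply: hg; rewrite inE iNs orbT.
  by apply: hB; rewrite inE negb_or iNs andbT; apply: contraNneq iNs => ->.
have hj : h j = g j by apply: hg; rewrite inE eqxx.
pose W x := \prod_(i | i != j) h i (Z i x).
have mh i : measurable_fun setT (h i).
  case: (boolP (i \in j :: s)) => [/hg ->//|/hB[B mB ->]].
  exact: measurable_indic.
have h0 i y : 0 <= h i y.
  by case: (boolP (i \in j :: s)) => [/hg ->//|/hB[B mB ->]].
have hoo i : (\int[P]_x (h i (Z i x))%:E)%E \is a fin_num.
  rewrite ge0_fin_numE; last first.
    by apply: integral_ge0 => x _; rewrite lee_fin.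
  case: (boolP (i \in j :: s)) => [/hg ->//|/hB[B mB ->]].
  apply: (@le_lt_trans _ _ (\int[P]_x 1)%E).
    apply: ge0_le_integral => //.
    - by apply/measurable_EFinP/measurableT_comp => //; exact: measurable_indic.
    - by move=> x _; rewrite lee_fin indicE lern1 leq_b1.
  by rewrite integral_cst// mul1e (le_lt_trans (probability_le1 _ _))// ltry.
have mW : measurable_fun setT W.
  rewrite /W; under eq_fun do rewrite -big_filter.
  by apply: measurable_prod => i _; apply: measurableT_comp.
have W0 x : 0 <= W x by exact: prodr_ge0.
(* Finiteness of every factor makes this product a real number, so it can scale a measure. *)
pose c := \prod_(i | i != j) fine (\int[P]_x (h i (Z i x))%:E)%E.
have c0 : 0 <= c.
  apply: prodr_ge0 => i _; apply/fine_ge0/integral_ge0 => x _.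
  by rewrite lee_fin.
have cE : c%:E = (\prod_(i | i != j) \int[P]_x (h i (Z i x))%:E)%E.
  by rewrite -prodEFin; apply: eq_bigr => i _; rewrite fineK.
(* The target measure is the law of [Z j] times the expectations of the other factors. The set
   identity required of it has an indicator in place [j], so it is the induction hypothesis for the
   modified family [h'] below. *)
pose nu := mscale (NngNum c0) (distribution P (Z j)).
rewrite [RHS](bigD1 j)//= -cE muleC.
under eq_integral do rewrite (bigD1 j)//= -/(W _) mulrC.
have mhj : measurable_fun setT (fun y => (h j y)%:E) by exact/measurable_EFinP.
rewrite (ge0_integral_density P nu W (Z j) (h j)) //.
- rewrite ge0_integral_mscale//; last by move=> y _; rewrite lee_fin.
  by rewrite ge0_integral_distribution// => y; rewrite lee_fin.
- move=> B mB; rewrite /nu/= /mscale/= /distribution/= /pushforward.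
  pose h' i := if i == j then \1_B else h i.
  have hNj i : i != j -> h' i = h i by rewrite /h' => /negPf ->.
  have h'j : h' j = \1_B by rewrite /h' eqxx.
  have mZB : measurable (Z j @^-1` B) by exact: measurable_funPTI.
  have := IHs h'.
  rewrite (bigD1 j)//= [X in (X * _)%E](_ : _ = P (Z j @^-1` B)); last first.
    under eq_integral do rewrite h'j.
    by rewrite -[in RHS](setIT (_ @^-1` _)) -integral_indic.
  rewrite (eq_bigr (fun i => \int[P]_x (h i (Z i x))%:E)%E); last first.
    by move=> i ij; under eq_integral do rewrite hNj//.
  rewrite -cE muleC => <-.
  + rewrite integral_mkcond; apply: eq_integral => x _.
    rewrite patchE (bigD1 j)//= h'j indicE.
    rewrite (_ : (x \in Z j @^-1` B) = (Z j x \in B)); last first.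
      by apply/idP/idP; rewrite !inE.
    case: ifPn => _; rewrite ?mul0r// mul1r.
    by congr EFin; apply: eq_bigr => i /hNj ->.
  + move=> i iNs; rewrite hNj; first by apply: hg; rewrite inE iNs orbT.
    by apply: contraNneq js => <-.
  + move=> i iNs; have [->|ij] := eqVneq i j; first by exists B.
    by rewrite hNj//; apply: hB; rewrite inE negb_or ij.
Qed.

(** * Numerical estimates for the two Chernoff tails *)

Lemma series_exp_coeff_le_expR {R : realType} (n : nat) {x : R} : 0 <= x ->
  \sum_(i < n) x ^+ i / i`!%:R <= expR x.
Proof.
move=> x0; rewrite -(big_mkord xpredT (fun i => x ^+ i / i`!%:R)).
apply: (@nondecreasing_cvgn_le _ (series (exp_coeff x))).
  by apply/nondecreasing_seqP => k; rewrite /series/= big_nat_recr//= lerDl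
    divr_ge0// exprn_ge0.
exact: is_cvg_series_exp_coeff.
Qed.

(** Write [w = 27/10 + h] with [h >= 0]. Since [3/2 * 27/10 = 4 + 1/20], the exponential splits into
    [expR 1 ^+ 4], bounded below through [27/10 <= expR 1], and [expR (1/20 + 3/2 h)], bounded below
    by its Taylor polynomial of degree four, the degree of the left-hand side. *)
Lemma cubic_le_expR {R : realType} (w : R) : expR 1 <= w ->
  w ^+ 3 * (2 * w + 3) <= 3 * expR (3 / 2 * w).
Proof.
have e27 : 27 / 10 <= expR 1 :> R.
  apply: le_trans _ (series_exp_coeff_le_expR 6 ler01).
  by rewrite !big_ord_recr big_ord0/= !expr1n !factS fact0; lra.
move=> /(le_trans e27) w27.
pose h := w - 27 / 10; have h0 : 0 <= h by rewrite subr_ge0.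
have -> : 3 / 2 * w = 4%:R * 1 + (1 / 20 + 3 / 2 * h) by rewrite /h; field.
rewrite expRD expRM_natl.
have -> : w = 27 / 10 + h by rewrite /h; ring.
have e4 : (27 / 10) ^+ 4 <= expR 1 ^+ 4 :> R.
  by rewrite lerXn2r// nnegrE ?expR_ge0//; lra.
have t0 : 0 <= 1 / 20 + 3 / 2 * h by lra.
have := series_exp_coeff_le_expR 5 t0.
rewrite !big_ord_recr big_ord0/= !factS fact0 => eh.
apply: (@le_trans _ _ (3 * ((27 / 10) ^+ 4 * expR (1 / 20 + 3 / 2 * h))));
  last first.
  by rewrite ler_pM2l// ler_wpM2r// expR_ge0.
set E := expR _ in eh *.
(* Expanded in powers of [h], the quartic on the left is dominated coefficient by coefficient. *)
have h2 := exprn_ge0 2 h0; have h3 := exprn_ge0 3 h0; have h4 := exprn_ge0 4 h0.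
nra.
Qed.

(* After division by the right-hand side both terms decrease in [k], so [k = 3]
   is the worst case; there [expR (- y) <= 1 / (1 + y)] with [y = 3 / (2 w)]
   leaves [cubic_le_expR]. *)
Lemma sum_expR_tail_le {R : realType} (k w : R) : expR 1 < w -> 3 <= k ->
  expR (k / 2 * (1 - w^-1 - ln w)) + expR (k / 2 * (1 - w + ln w))
    <= expR (k / 2 * (1 - ln w)).
Proof.
move=> ew k3; have w0 : 0 < w by apply: lt_trans ew; exact: expR_gt0.
have lnw : ln w <= w / expR 1.
  have := expR_ge1Dx (ln w - 1).
  by rewrite expRB lnK ?posrE// addrCA subrr addr0.
have e2 : 2 <= expR 1 :> R by have := expR_ge1Dx (1 : R).
(* This sign makes the second term, after the division, nonincreasing in [k]. *)
have lnw2 : 2 * ln w - w <= 0.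
  rewrite subr_le0; apply: (@le_trans _ _ (2 * (w / expR 1))).
    by rewrite ler_pM2l.
  by rewrite mulrA ler_pdivrMr ?expR_gt0// mulrC ler_pM2l.
rewrite [X in expR X](_ : _ = k / 2 * (1 - ln w) + - (k / (2 * w))); last first.
  by field; rewrite gt_eqF.
rewrite [X in _ + expR X](_ : _ = k / 2 * (1 - ln w) + k / 2 * (2 * ln w - w));
  last by field.
rewrite !expRD -mulrDr ler_piMr ?expR_ge0//.
apply: (@le_trans _ _ (expR (- (3 / (2 * w))) + expR (3 / 2 * (2 * ln w - w)))).
  apply: lerD; rewrite ler_expR.
    by rewrite lerN2 ler_pM2r// invr_gt0 mulr_gt0.
  by rewrite ler_wnM2r//; lra.
have h1 : expR (- (3 / (2 * w))) <= 2 * w / (2 * w + 3).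
  rewrite expRN -[leRHS]invrK lef_pV2 ?posrE ?expR_gt0 ?invr_gt0 ?divr_gt0//;
    try lra.
  apply: le_trans (expR_ge1Dx _); rewrite invf_div le_eqVlt; apply/orP; left.
  by apply/eqP; field; rewrite gt_eqF.
have h2 : expR (3 / 2 * (2 * ln w - w)) <= 3 / (2 * w + 3).
  rewrite [X in expR X](_ : _ = 3%:R * ln w - 3 / 2 * w); last by field.
  rewrite expRB expRM_natl lnK ?posrE// ler_pdivrMr ?expR_gt0//.
  rewrite mulrAC ler_pdivlMr; last lra.
  exact: cubic_le_expR (ltW ew).
apply: le_trans (lerD h1 h2) _.
by rewrite -mulrDl divff// gt_eqF//; lra.
Qed.

(** * Exponential moments and parameters of real Gaussian laws *)

Lemma ge0_integral_law {d d'} {T : measurableType d} {T' : measurableType d'}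
    {R : realType} {P : probability T R} (X : T -> T')
    (nu : {measure set T' -> \bar R}) (g : T' -> R) :
  measurable_fun setT X -> (forall B, measurable B -> P (X @^-1` B) = nu B) ->
  measurable_fun setT g -> (forall y, 0 <= g y) ->
  (\int[P]_x (g (X x))%:E = \int[nu]_y (g y)%:E)%E.
Proof.
move=> mX Xnu mg g0.
rewrite -(ge0_integral_density P nu (fun=> 1) X g) => // [|B mB].
  by apply: eq_integral => x _; rewrite mul1r.
have mXB : measurable (X @^-1` B) by rewrite -[_ @^-1` _]setTI; exact: mX.
by rewrite integral_cst// mul1e; exact: Xnu.
Qed.

Lemma ge0_integral_normal_prob {R : realType} (m s : R) (g : R -> R) :
  measurable_fun setT g -> (forall y, 0 <= g y) ->
  (\int[normal_prob m s]_y (g y)%:E =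
    \int[lebesgue_measure]_y (normal_pdf m s y * g y)%:E)%E.
Proof.
move=> mg g0; apply/esym.
apply: (ge0_integral_density lebesgue_measure (normal_prob m s)
  (normal_pdf m s) id) => //.
- exact: measurable_normal_pdf.
- exact: normal_pdf_ge0.
Qed.

(** Completing the square turns the integrand into a constant times the normal density with mean
    shifted to [m + s ^+ 2 * t]. *)
Lemma gaussian_law_mgf {d} {T : measurableType d} {R : realType}
    {P : probability T R} (X : T -> R) (m s t : R) :
  measurable_fun setT X ->
  (forall B, measurable B -> P (X @^-1` B) = gaussian_law m s B) ->
  (\int[P]_x (expR (t * X x))%:E = (expR (m * t + s ^+ 2 * t ^+ 2 / 2))%:E)%E.
Proof.
move=> mX; rewrite /gaussian_law.
have mg : measurable_fun setT (fun y : R => expR (t * y)).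
  by apply: measurableT_comp => //; exact: measurable_funM.
case: eqVneq => [-> XP|s0 XP].
  rewrite (ge0_integral_law X _ _ mX XP mg)//.
  rewrite integral_dirac//; last exact/measurable_EFinP.
  by rewrite diracT mul1e expr0n/= !mul0r addr0 mulrC.
(* [normal_prob] is a measure on [measurableTypeR R], which is convertible to
   the canonical structure on [R] but not found by unification. *)
rewrite (@ge0_integral_law _ _ _ (measurableTypeR R) _ _ X (normal_prob m s) _
  mX XP mg)//.
rewrite ge0_integral_normal_prob//.
transitivity (\int[lebesgue_measure]_y
    ((expR (m * t + s ^+ 2 * t ^+ 2 / 2))%:E *
     (normal_pdf (m + s ^+ 2 * t) s y)%:E))%E.
  apply: eq_integral => y _; rewrite -EFinM !normal_pdfE//= /normal_fun.
  congr EFin.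
  by rewrite [RHS]mulrCA -[LHS]mulrA -!expRD; congr (_ * expR _); field.
rewrite ge0_integralZl//=.
- by rewrite integral_normal_pdf mule1.
- by apply/measurable_EFinP; exact: measurable_normal_pdf.
- by move=> y _; rewrite lee_fin normal_pdf_ge0.
Qed.

(** With [c = sqrt (1 - 2 t s^2)], the factor [expR (t y^2)] turns the centered density of parameter
    [s] into the one of parameter [s / c]; comparing peak heights leaves [1 / c]. *)
Lemma gaussian_law_expR_sqr {d} {T : measurableType d} {R : realType}
    {P : probability T R} (X : T -> R) (s t : R) :
  measurable_fun setT X ->
  (forall B, measurable B -> P (X @^-1` B) = gaussian_law 0 s B) ->
  2 * t * s ^+ 2 < 1 ->
  (\int[P]_x (expR (t * X x ^+ 2))%:E =
    (Num.sqrt (1 - 2 * t * s ^+ 2))^-1%:E)%E.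
Proof.
move=> mX; rewrite /gaussian_law.
have mg : measurable_fun setT (fun y : R => expR (t * y ^+ 2)).
  by apply: measurableT_comp => //; exact: measurable_funM.
case: eqVneq => [-> XP|s0 XP ts].
  rewrite (ge0_integral_law X _ _ mX XP mg)//.
  rewrite integral_dirac//; last exact/measurable_EFinP.
  by rewrite diracT mul1e expr0n/= !mulr0 subr0 sqrtr1 invr1 expR0.
rewrite (@ge0_integral_law _ _ _ (measurableTypeR R) _ _ X (normal_prob 0 s) _
  mX XP mg)//.
rewrite ge0_integral_normal_prob//.
set c := Num.sqrt _.
have c0 : 0 < c by rewrite sqrtr_gt0 subr_gt0.
have cE : c ^+ 2 = 1 - 2 * t * s ^+ 2 by rewrite sqr_sqrtr// subr_ge0 ltW.
have sc0 : s / c != 0 by rewrite mulf_neq0// invr_neq0// gt_eqF.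
have c0' : c != 0 by rewrite gt_eqF.
transitivity (\int[lebesgue_measure]_y
    ((c^-1)%:E * (normal_pdf 0 (s / c) y)%:E))%E.
  apply: eq_integral => y _; rewrite -EFinM !normal_pdfE//= /normal_fun.
  congr EFin.
  rewrite [RHS]mulrA -[LHS]mulrA -!expRD; congr (_ * expR _); last first.
    rewrite exprMn exprVn cE; field.
    by rewrite s0 -cE sqrf_eq0 c0'.
  rewrite /normal_peak.
  have -> : (s / c) ^+ 2 * pi *+ 2 = s ^+ 2 * pi *+ 2 * c^-1 ^+ 2 :> R.
    by field.
  rewrite sqrtrM; last by apply: mulrn_wge0; rewrite mulr_ge0 ?sqr_ge0 ?pi_ge0.
  by rewrite sqrtr_sqr gtr0_norm ?invr_gt0// invfM invrK mulrCA mulVf// mulr1.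
rewrite ge0_integralZl//=.
- by rewrite integral_normal_pdf mule1.
- by apply/measurable_EFinP; exact: measurable_normal_pdf.
- by move=> y _; rewrite lee_fin normal_pdf_ge0.
- by rewrite lee_fin invr_ge0 ltW.
Qed.

(** A nonzero linear term would win near [t = 0]. The test point [- m / (1 + v)] is small enough for
    this, and its denominator is positive even when [v = 0]. *)
Lemma linear_coef_eq0 {R : realFieldType} (m v : R) :
  (forall t, 0 <= m * t + v * t ^+ 2 / 2) -> 0 <= v -> m = 0.
Proof.
move=> H v0; apply/eqP; rewrite -sqrf_eq0 eq_le sqr_ge0 andbT.
have v1 : 0 < 1 + v by lra.
have := H (- m / (1 + v)).
rewrite (_ : _ + _ = - (m ^+ 2 * (2 + v) / (2 * (1 + v) ^+ 2))); last first.
  by field; rewrite gt_eqF.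
rewrite oppr_ge0 pmulr_lle0 ?invr_gt0 ?mulr_gt0 ?exprn_gt0// pmulr_lle0//; lra.
Qed.

(* With [c = sqrt (1 - 2 t v)] the hypothesis reads
   [1 + (1 - c^2) q / (2 v) <= 1 / c]: both sides agree at [c = 1], so their
   derivatives there, [- q / v] and [- 1], are equal. *)
Lemma eq_of_sqrt_inv_ge {R : rcfType} (v q : R) : 0 <= v -> 0 <= q ->
  (forall t, 2 * t * v < 1 -> 1 + t * q <= (Num.sqrt (1 - 2 * t * v))^-1) ->
  v = q.
Proof.
rewrite le_eqVlt => /predU1P[<- q0 H|v0 q0 H].
  apply/eqP; rewrite eq_le q0/=; have := H 1.
  by rewrite mulr0 subr0 sqrtr1 invr1 => /(_ ltr01); lra.
pose k := q / (2 * v).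
have k0 : 0 <= k by rewrite divr_ge0// mulr_ge0// ltW.
have qE : q = 2 * v * k by rewrite /k; field; rewrite gt_eqF.
have {}H c : 0 < c -> c * (1 + (1 - c ^+ 2) * k) <= 1.
  move=> c0; have := H ((1 - c ^+ 2) / (2 * v)).
  rewrite (_ : 2 * _ * v = 1 - c ^+ 2); last by field; rewrite gt_eqF.
  rewrite (_ : _ / _ * q = (1 - c ^+ 2) * k); last first.
    by rewrite /k; field; rewrite gt_eqF.
  rewrite subKr sqrtr_sqr gtr0_norm// -[c^-1]mul1r ler_pdivlMr// mulrC.
  by apply; rewrite ltrBlDr ltrDl exprn_gt0.
have [k2|k2|k2] := ltgtP (2 * k) 1.
(* For [2 k < 1] the inequality fails at [c = 1 + e]: with [k = 1/2 - 4 e] the excess over 1 is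
   [e ^+ 2] times a positive polynomial. *)
- pose e := (1 - 2 * k) / 8.
  have e0 : 0 < e by rewrite divr_gt0// subr_gt0.
  have /H : 0 < 1 + e by lra.
  rewrite (_ : _ * _ = 1 + e ^+ 2 * (13 / 2 + 23 / 2 * e + 4 * e ^+ 2)).
    rewrite gerDl leNgt pmulr_rgt0 ?exprn_gt0// => /negP[].
    by rewrite addr_gt0 ?mulr_gt0 ?exprn_gt0//; lra.
  have -> : k = 1 / 2 - 4 * e by rewrite /e; field.
  by field.
(* For [2 k > 1] it fails at [c = 1 - e]; this [e] makes the negative contribution [3 e k] exactly
   half of [2 k - 1]. *)
- pose e := (2 * k - 1) / (6 * k).
  have kgt0 : 0 < k by lra.
  have ek : e * k = (2 * k - 1) / 6 by rewrite /e; field; rewrite gt_eqF.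
  have e0 : 0 < e by apply: divr_gt0; lra.
  have e1 : e < 1 by rewrite /e ltr_pdivrMr; lra.
  have /H : 0 < 1 - e by lra.
  rewrite (_ : _ * _ = 1 + e * (2 * k - 1 - 3 * (e * k) + e * (e * k)));
    last by ring.
  rewrite gerDl leNgt pmulr_rgt0// => /negP[].
  have := mulr_gt0 e0 (mulr_gt0 e0 kgt0); lra.
- by rewrite qE mulrAC k2 mul1r.
Qed.

Lemma integrable_expR_of_gaussian_law {d} {T : measurableType d} {R : realType}
    {P : probability T R} (X : T -> R) (m s t : R) :
  measurable_fun setT X ->
  (forall B, measurable B -> P (X @^-1` B) = gaussian_law m s B) ->
  P.-integrable setT (fun x => (expR (t * X x))%:E).
Proof.
move=> mX XP; apply/integrableP; split.
  apply/measurable_EFinP; apply: measurableT_comp => //.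
  exact: measurable_funM.
under eq_integral do rewrite /= ger0_norm ?expR_ge0//.
by rewrite (gaussian_law_mgf X m s)// ltry.
Qed.

(** Dominates the square by exponentials whose integrals are known, so that second moments of
    Gaussian laws are finite. *)
Lemma sqr_le_expRD {R : realType} (x : R) : x ^+ 2 <= 2 * (expR x + expR (- x)).
Proof.
wlog x0 : x / 0 <= x => [H|].
  have [|x0] := leP 0 x; first exact: H.
  have := H (- x); rewrite sqrrN opprK [expR _ + _]addrC.
  by apply; rewrite oppr_ge0 ltW.
have := expR_ge1Dxn 1 x0; rewrite !factS fact0.
have := expR_ge0 (- x); lra.
Qed.

Lemma integrable_sqr_of_gaussian_law {d} {T : measurableType d} {R : realType}
    {P : probability T R} (X : T -> R) (m s : R) :
  measurable_fun setT X ->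
  (forall B, measurable B -> P (X @^-1` B) = gaussian_law m s B) ->
  P.-integrable setT (fun x => (X x ^+ 2)%:E).
Proof.
move=> mX XP; apply: (@le_integrable _ _ _ _ _ _ _
    (fun x => 2%:E * ((expR (1 * X x))%:E + (expR (- 1 * X x))%:E))%E) => //.
- by apply/measurable_EFinP; exact: measurable_funX.
- move=> x _; rewrite -EFinD -EFinM !abse_EFin lee_fin mul1r mulN1r.
  by rewrite !ger0_norm ?sqr_ge0 ?sqr_le_expRD// mulr_ge0// addr_ge0 ?expR_ge0.
- apply: integrableZl => //; apply: integrableD => //;
    exact: (integrable_expR_of_gaussian_law X m s).
Qed.

Lemma integrable_of_integrable_sqr {d} {T : measurableType d} {R : realType}
    {P : probability T R} (X : T -> R) :
  measurable_fun setT X -> P.-integrable setT (fun x => (X x ^+ 2)%:E) ->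
  P.-integrable setT (fun x => (X x)%:E).
Proof.
move=> mX iX; apply: (@le_integrable _ _ _ _ _ _ _
    (fun x => 1%:E + (X x ^+ 2)%:E)%E) => //.
- exact/measurable_EFinP.
- move=> x _; rewrite -EFinD !abse_EFin lee_fin.
  rewrite [leRHS]ger0_norm ?addr_ge0 ?sqr_ge0//.
  rewrite ler_norml; apply/andP; split; nra.
- apply: integrableD => //.
  exact: (finite_measure_integrable_cst P (1 : R)).
Qed.

(** Integrating [1 + x <= expR x] at [t X] and then at [t X^2] puts an affine function of [t], built
    from the true moment, below the known exponential moment. Both agree at [t = 0], so the slopes
    there match. The mean comes first because the formula for [X^2] concerns centered laws. *)
Lemma gaussian_law_centered {d} {T : measurableType d} {R : realType}
    {P : probability T R} (X : T -> R) (m s q : R) :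
  measurable_fun setT X ->
  (forall B, measurable B -> P (X @^-1` B) = gaussian_law m s B) ->
  (\int[P]_x (X x)%:E = 0)%E -> (\int[P]_x (X x ^+ 2)%:E = q%:E)%E ->
  m = 0 /\ s ^+ 2 = q.
Proof.
move=> mX XP X1 X2.
have iX2 := integrable_sqr_of_gaussian_law X m s mX XP.
have iX := integrable_of_integrable_sqr X mX iX2.
have i1 : P.-integrable setT (fun=> 1%:E).
  exact: (finite_measure_integrable_cst P (1 : R)).
have int1 : (\int[P]_x 1%:E = 1%:E)%E.
  by rewrite integral_cst//= probability_setT mule1.
have m0 : m = 0.
  apply: (@linear_coef_eq0 _ _ (s ^+ 2)); last exact: sqr_ge0.
  move=> t; rewrite -ler_expR expR0 -lee_fin -(gaussian_law_mgf X _ _ _ mX XP).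
  have -> : (1%:E = \int[P]_x (1%:E + t%:E * (X x)%:E))%E.
    rewrite integralD//= ?integralZl ?X1 ?mule0 ?adde0//.
    exact: integrableZl.
  apply: le_integral => //.
  - by apply: integrableD => //; exact: integrableZl.
  - exact: (integrable_expR_of_gaussian_law X m s).
  - by move=> x _; rewrite -EFinM -EFinD lee_fin expR_ge1Dx.
split=> //; apply: eq_of_sqrt_inv_ge; first exact: sqr_ge0.
  by rewrite -lee_fin -X2 integral_ge0// => x _; rewrite lee_fin sqr_ge0.
move=> t ts; rewrite m0 in XP.
rewrite -lee_fin -(gaussian_law_expR_sqr X _ _ mX XP)//.
have -> : ((1 + t * q)%:E = \int[P]_x (1%:E + t%:E * (X x ^+ 2)%:E))%E.
  by rewrite integralD//= ?integralZl ?X2 ?int1//; exact: integrableZl.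
apply: le_integral => //.
- by apply: integrableD => //; exact: integrableZl.
- apply/integrableP; split.
    apply/measurable_EFinP; apply: measurableT_comp => //.
    by apply: measurable_funM => //; exact: measurable_funX.
  under eq_integral do rewrite /= ger0_norm ?expR_ge0//.
  by rewrite (gaussian_law_expR_sqr X s)// ltry.
- by move=> x _; rewrite -EFinM -EFinD lee_fin expR_ge1Dx.
Qed.

(** * Linear functionals of Gaussian vectors *)

Lemma dotvE {R : pzRingType} {N : nat} (a b : 'cV[R]_N) :
  dotv a b = \sum_i a i ord0 * b i ord0.
Proof. by rewrite /dotv mxE; apply: eq_bigr => i _; rewrite mxE. Qed.

Lemma dotv_colvE {R : realType} {N : nat} (a : 'cV[R]_N) (t : N.-tuple R) :
  dotv a (colv t) = \sum_i a i ord0 * tnth t i.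
Proof. by rewrite dotvE; apply: eq_bigr => i _; rewrite mxE. Qed.

Lemma measurable_dotv_colv {R : realType} {N : nat} (a : 'cV[R]_N) :
  measurable_fun setT (fun t : N.-tuple R => dotv a (colv t)).
Proof.
under eq_fun do rewrite dotv_colvE.
apply: measurable_sum => i; apply: measurable_funM => //.
exact: measurable_tnth.
Qed.

Section gaussian_vectors.
Context {d} {T : measurableType d} {R : realType} {P : probability T R}
  {N : nat}.
Implicit Types (Z : {RV P >-> N.-tuple R}) (a : 'cV[R]_N) (S : 'M[R]_N).

Lemma measurable_dotv_RV Z a :
  measurable_fun setT (fun om => dotv a (colv (Z om))).
Proof.
apply: (@measurableT_comp _ _ _ _ _ _ (fun t => dotv a (colv t))) => //.
exact: measurable_dotv_colv.
Qed.

Lemma measurable_tnth_RV Z i : measurable_fun setT (fun om => tnth (Z om) i).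
Proof.
apply: (@measurableT_comp _ _ _ _ _ _ (fun t : N.-tuple R => tnth t i)) => //.
exact: measurable_tnth.
Qed.

Lemma gaussian_vector_integrable_sqr Z i : gaussian_vector Z ->
  P.-integrable setT (fun om => (tnth (Z om) i ^+ 2)%:E).
Proof.
move=> gZ; have [m [s HX]] := gZ (delta_mx i ord0).
apply: (integrable_sqr_of_gaussian_law _ m s); first exact: measurable_tnth_RV.
move=> B mB; rewrite -HX//; congr (P _); apply/seteqP.
have E om : dotv (delta_mx i ord0) (colv (Z om)) = tnth (Z om) i.
  rewrite dotv_colvE (bigD1 i)//= mxE !eqxx mul1r big1 ?addr0// => j /negPf ji.
  by rewrite mxE ji mul0r.
by split=> om /=; rewrite E.
Qed.

(** Gaussianity gives each functional a normal law with unknown parameters; these are identified by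
    expanding its first two moments over the coordinates. The cross products are integrable because
    they are dominated by sums of squares. *)
Lemma gaussian_vector_dotv_law Z S a : gaussian_vector Z -> has_mean Z 0 ->
  has_covariance Z S -> exists2 s, s ^+ 2 = dotv a (S *m a) &
    forall B, measurable B ->
      P ((fun om => dotv a (colv (Z om))) @^-1` B) = gaussian_law 0 s B.
Proof.
move=> gZ meanZ covZ; have [m [s HX]] := gZ a.
have iZ2 i := gaussian_vector_integrable_sqr Z i gZ.
have mZ := measurable_tnth_RV Z.
have iZ i := integrable_of_integrable_sqr _ (mZ i) (iZ2 i).
have meanE i : (\int[P]_x (tnth (Z x) i)%:E = 0)%E.
  by have := meanZ i; rewrite unlock mxE.
have iZZ i j : P.-integrable setT (fun x => (tnth (Z x) i * tnth (Z x) j)%:E).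
  apply: (@le_integrable _ _ _ _ _ _ _
    (fun x => (tnth (Z x) i ^+ 2)%:E + (tnth (Z x) j ^+ 2)%:E)%E) => //.
  - by apply/measurable_EFinP; exact: measurable_funM.
  - move=> x _; rewrite -EFinD !abse_EFin lee_fin.
    rewrite [leRHS]ger0_norm ?addr_ge0 ?sqr_ge0//.
    by rewrite ler_norml; apply/andP; split; nra.
  - exact: integrableD.
have covE i j : (\int[P]_x (tnth (Z x) i * tnth (Z x) j)%:E = (S i j)%:E)%E.
  have := covZ i j; rewrite unlock !meanZ !mxE/= unlock => <-.
  by apply: eq_integral => x _; rewrite /= !fctE/= !subr0.
have [m0 s2] : m = 0 /\ s ^+ 2 = dotv a (S *m a).
  apply: (gaussian_law_centered _ m s _ (measurable_dotv_RV Z a) HX).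
    under eq_integral do rewrite dotv_colvE -sumEFin.
    rewrite integral_sum//; last first.
      by move=> i; under eq_fun do rewrite EFinM; exact: integrableZl.
    rewrite big1// => i _; under eq_integral do rewrite EFinM.
    by rewrite integralZl// meanE mule0.
  transitivity (\int[P]_x (\sum_i \sum_j
      (a i ord0 * a j ord0)%:E * (tnth (Z x) i * tnth (Z x) j)%:E))%E.
    apply: eq_integral => x _; rewrite dotv_colvE expr2 mulr_suml -sumEFin.
    apply: eq_bigr => i _; rewrite mulr_sumr -sumEFin.
    by apply: eq_bigr => j _; rewrite -EFinM mulrACA.
  rewrite integral_sum//; last first.
    by move=> i; apply: integrable_sum => // j _; exact: integrableZl.
  rewrite dotvE -sumEFin; apply: eq_bigr => i _.
  rewrite integral_sum//; last by move=> j; exact: integrableZl.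
  rewrite mxE mulr_sumr -sumEFin; apply: eq_bigr => j _.
  by rewrite integralZl// covE -EFinM; congr EFin; ring.
by exists s => // B mB; rewrite HX// m0.
Qed.

End gaussian_vectors.

(** * Concentration of the sums of squares *)

Lemma measurable_set_le {d} {T : measurableType d} {R : realType}
    (f g : T -> R) : measurable_fun setT f -> measurable_fun setT g ->
  measurable [set x | f x <= g x].
Proof.
by move=> mf mg; rewrite -[X in measurable X]setTI; exact: measurable_fun_le.
Qed.

Lemma expectation_indic_le {d} {T : measurableType d} {R : realType}
    {P : probability T R} (A : set T) (f : T -> R) :
  measurable A -> measurable_fun setT f -> (forall x, 0 <= f x) ->
  (forall x, A x -> 1 <= f x) -> (P A <= \int[P]_x (f x)%:E)%E.
Proof.
move=> mA mf f0 f1; rewrite -[A in P A]setIT -integral_indic//.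
apply: ge0_le_integral => //.
- by apply/measurable_EFinP; exact: measurable_indic.
- exact/measurable_EFinP.
- move=> x _; rewrite lee_fin indicE.
  by case: (boolP (x \in A)) => [/set_mem/f1|].
Qed.

Lemma measure_bigsetU_seq_le {d} {T : measurableType d} {R : realType}
    {P : probability T R} {I : Type} (s : seq I) (F : I -> set T) (e : R) :
  (forall i, measurable (F i)) -> (forall i, (P (F i) <= e%:E)%E) ->
  (P (\big[setU/set0]_(i <- s) F i) <= ((size s)%:R * e)%:E)%E.
Proof.
move=> mF Fe; elim: s => [|i s IHs].
  by rewrite big_nil measure0 mul0r.
rewrite big_cons; apply: (le_trans (measureU2 _ _ _)) => //.
  by apply: bigsetU_measurable => j _.
by rewrite /= mulrSr mulrDl mul1r addrC EFinD leeD.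
Qed.

Section gaussian_samples.
Context {d} {T : measurableType d} {R : realType} {P : probability T R}
  {N K : nat} (S : 'M[R]_N) (Z : 'I_K -> {RV P >-> N.-tuple R}).
Context (Zind : mutually_independent Z)
  (Zgauss : forall i, gaussian_vector (Z i))
  (Zmean : forall i, has_mean (Z i) 0)
  (Zcov : forall i, has_covariance (Z i) S).

Definition sample_sum_sqr (a : 'cV[R]_N) (om : T) : R :=
  \sum_i dotv a (colv (Z i om)) ^+ 2.

Lemma measurable_sample_sum_sqr a : measurable_fun setT (sample_sum_sqr a).
Proof.
apply: measurable_sum => i; apply: measurable_funX.
exact: measurable_dotv_RV.
Qed.

(* [b = w] gives the lower tail and [b = w^-1] the upper tail. *)
Lemma sample_sum_sqr_chernoff (a : 'cV[R]_N) (b : R) :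
  0 < b -> 0 < dotv a (S *m a) ->
  (P [set om | (0 <= (1 - b) *
        (sample_sum_sqr a om - K%:R * dotv a (S *m a) / b))%R]
    <= (expR (K%:R / 2 * (1 - b^-1 - ln b)))%:E)%E.
Proof.
(* This [t] minimizes the Chernoff bound, as it makes [1 - 2 t q = b]. Its sign is that of [1 - b],
   which selects the tail. *)
set q := dotv a (S *m a) => b0 q0; pose t := (1 - b) / (2 * q).
have mS := measurable_sample_sum_sqr a.
have tq : 2 * t * q = 1 - b by rewrite /t; field; rewrite gt_eqF.
have mgf i : (\int[P]_x (expR (t * dotv a (colv (Z i x)) ^+ 2))%:E =
    (Num.sqrt b)^-1%:E)%E.
  have [s sE XP] :=
      gaussian_vector_dotv_law (Z i) S a (Zgauss i) (Zmean i) (Zcov i).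
  rewrite (gaussian_law_expR_sqr _ s t (measurable_dotv_RV (Z i) a) XP) sE -/q.
    by rewrite tq subKr.
  by rewrite tq ltrBlDr ltrDl.
pose f om := expR (- (t * (K%:R * q / b))) * expR (t * sample_sum_sqr a om).
apply: (@le_trans _ _ (\int[P]_om (f om)%:E)%E).
  apply: expectation_indic_le.
  - apply: measurable_set_le => //; apply: measurable_funM => //.
    exact: measurable_funB.
  - apply: measurable_funM => //; apply: measurableT_comp => //.
    exact: measurable_funM.
  - by move=> x; rewrite mulr_ge0 ?expR_ge0.
  - move=> om /= H; rewrite /f -expRD -[leLHS]expR0 ler_expR.
    rewrite (_ : _ + _ =
        (1 - b) * (sample_sum_sqr a om - K%:R * q / b) / (2 * q)).
      by rewrite divr_ge0// mulr_ge0// ltW.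
    by rewrite /t; field; rewrite !gt_eqF.
under eq_integral do rewrite EFinM.
rewrite ge0_integralZl//=; last first.
- apply/measurable_EFinP; apply: measurableT_comp => //.
  exact: measurable_funM.
pose g := fun y : N.-tuple R => expR (t * dotv a (colv y) ^+ 2).
have mg : measurable_fun setT g.
  apply: measurableT_comp => //; apply: measurable_funM => //.
  by apply: measurable_funX; exact: measurable_dotv_colv.
rewrite (_ : (\int[P]_x _)%E = (\prod_(i < K) (Num.sqrt b)^-1)%:E); last first.
  transitivity (\int[P]_x (\prod_i g (Z i x))%:E)%E.
    apply: eq_integral => x _; rewrite /sample_sum_sqr mulr_sumr expR_sum//.
  rewrite (ge0_expectation_prod Z (fun=> g))//.
  - by rewrite -prodEFin; apply: eq_bigr => i _; exact: mgf.
  - by move=> i y; exact: expR_ge0.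
  - by move=> i; rewrite mgf ltry.
rewrite prodr_const card_ord -EFinM lee_fin.
rewrite (_ : (Num.sqrt b)^-1 = expR (- (ln b / 2))).
  rewrite -expRM_natl -expRD ler_expR le_eqVlt; apply/orP; left; apply/eqP.
  by rewrite /t; field; rewrite !gt_eqF.
have bE : b = expR (ln b / 2) ^+ 2.
  by rewrite -expRM_natl mulrC divfK// lnK.
by rewrite expRN {1}bE sqrtr_sqr ger0_norm ?expR_ge0.
Qed.

Definition concentration_set (w : R) (a : 'cV[R]_N) : set T :=
  [set om | w^-1 * (K%:R * dotv a (S *m a)) <= sample_sum_sqr a om
              <= w * (K%:R * dotv a (S *m a))].

Lemma measurable_concentration_set w a : measurable (concentration_set w a).
Proof.
have mS := measurable_sample_sum_sqr a.
rewrite (_ : concentration_set w a =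
    [set om | w^-1 * (K%:R * dotv a (S *m a)) <= sample_sum_sqr a om] `&`
    [set om | sample_sum_sqr a om <= w * (K%:R * dotv a (S *m a))]).
  by apply: measurableI; apply: measurable_set_le.
by apply/seteqP; split=> om /andP.
Qed.

(** If the variance of the functional vanishes, which a singular [S] allows, its law is the Dirac
    mass at 0 and both bounds hold almost surely as [0 <= 0]. Otherwise the two Chernoff events
    cover the complement and [sum_expR_tail_le] merges their bounds. *)
Lemma probability_concentration_setC (w : R) (a : 'cV[R]_N) :
  expR 1 < w -> 3 <= K%:R :> R -> 0 <= dotv a (S *m a) ->
  (P (~` concentration_set w a) <= (expR (K%:R / 2 * (1 - ln w)))%:E)%E.
Proof.
move=> ew K3; have w0 : 0 < w by apply: lt_trans ew; exact: expR_gt0.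
have w1 : 1 < w by apply: lt_trans ew; rewrite expR_gt1.
have mC : measurable (~` concentration_set w a).
  exact/measurableC/measurable_concentration_set.
rewrite le_eqVlt => /predU1P[q0|q0].
  pose F i := (fun om => dotv a (colv (Z i om))) @^-1` (~` [set 0]).
  have mF i : measurable (F i).
    rewrite -[F i]setTI; apply: measurable_dotv_RV => //.
    exact: measurableC.
  have PF i : (P (F i) <= 0%:E)%E.
    have [s sE XP] :=
      gaussian_vector_dotv_law (Z i) S a (Zgauss i) (Zmean i) (Zcov i).
    rewrite XP; last exact: measurableC.
    by rewrite /gaussian_law -sqrf_eq0 sE -q0 eqxx diracE memNset//=.
  have := measure_bigsetU_seq_le (index_enum 'I_K) F 0 mF PF.
  rewrite mulr0 => PU; apply: (le_trans _ (le_trans PU _)); last first.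
    by rewrite lee_fin expR_ge0.
  apply: le_measure; rewrite ?inE//.
    by apply: bigsetU_measurable => i _.
  move=> om bad; apply: contrapT => nF; apply: bad.
  rewrite /concentration_set/= -q0 !mulr0 /sample_sum_sqr big1 ?lexx// => i _.
  apply/eqP; rewrite sqrf_eq0; apply/eqP; apply: contrapT => Xi0; apply: nF.
  by rewrite -bigcup_seq; exists i => //=; rewrite mem_index_enum.
pose A b := [set om | 0 <= (1 - b) *
  (sample_sum_sqr a om - K%:R * dotv a (S *m a) / b)].
have mA b : measurable (A b).
  apply: measurable_set_le => //; apply: measurable_funM => //.
  by apply: measurable_funB => //; exact: measurable_sample_sum_sqr.
have lo : (P (A w) <= (expR (K%:R / 2 * (1 - w^-1 - ln w)))%:E)%E.
  exact: sample_sum_sqr_chernoff.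
have hi : (P (A (w^-1)%R) <= (expR (K%:R / 2 * (1 - w + ln w)))%:E)%E.
  have := sample_sum_sqr_chernoff a w^-1.
  by rewrite -/(A _) lnV ?posrE// opprK invrK invr_gt0; exact.
apply: (@le_trans _ _ (expR (K%:R / 2 * (1 - w^-1 - ln w)) +
    expR (K%:R / 2 * (1 - w + ln w)))%:E); last first.
  by rewrite lee_fin; exact: sum_expR_tail_le.
rewrite EFinD; apply: (le_trans _ (leeD lo hi)).
apply: (le_trans _ (@measureU2 _ _ _ P _ _ (mA w) (mA w^-1))).
apply: le_measure; rewrite ?inE//; first exact: measurableU.
move=> om; rewrite /concentration_set/= => /negP; rewrite negb_and -!ltNge.
move=> /orP[lt|lt]; [left|right]; rewrite /A/=.
  by rewrite nmulr_rge0 ?subr_lt0// subr_le0 ltW// mulrC.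
rewrite pmulr_rge0 ?subr_gt0 ?invf_lt1// invrK subr_ge0 ltW// mulrC//.
Qed.

End gaussian_samples.

(** * From concentration to the estimator bounds *)

(** Numerator and denominator are each off by a factor at most [w], the quotient by at most
    [w ^+ 2], and the square root brings this back to [w]. The normalizations [c], [c'] and [k]
    cancel. *)
Lemma ratio_sqrt_bounds {R : rcfType} (w c c' k A B E U : R) :
  0 < w -> 0 < c -> 0 < c' -> 0 < k -> 0 <= E -> 0 < U ->
  w^-1 * (k * E) <= A <= w * (k * E) -> w^-1 * (k * U) <= B <= w * (k * U) ->
  w^-1 * Num.sqrt ((c * A) / (c * B)) <= Num.sqrt (c' * E) / Num.sqrt (c' * U)
    <= w * Num.sqrt ((c * A) / (c * B)).
Proof.
move=> w0 c0 c'0 k0 E0 U0 /andP[EA AE] /andP[UB BU].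
have w'0 : 0 < w^-1 by rewrite invr_gt0.
(* The lower bound keeps the denominator positive, so the convention [x / 0 = 0] never intervenes
   here. *)
have B0 : 0 < B by apply: lt_le_trans UB; rewrite !mulr_gt0.
have A0 : 0 <= A by apply: le_trans EA; rewrite !mulr_ge0// ltW.
have -> : (c * A) / (c * B) = A / B by field; rewrite !gt_eqF.
rewrite -sqrtrV; last by rewrite mulr_ge0// ltW.
rewrite -sqrtrM; last by rewrite mulr_ge0// ltW.
have -> : (c' * E) * (c' * U)^-1 = E / U by field; rewrite !gt_eqF.
have mulE (v x : R) : 0 < v -> v * Num.sqrt x = Num.sqrt (v ^+ 2 * x).
  by move=> v0; rewrite sqrtrM ?sqr_ge0// sqrtr_sqr gtr0_norm.
rewrite !mulE// exprVn; apply/andP; split; apply: ler_wsqrtr.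
  rewrite ler_pdivrMl ?exprn_gt0//.
  rewrite (_ : w ^+ 2 * (E / U) = (w * (k * E)) / (w^-1 * (k * U))).
    apply: ler_pM => //; first by rewrite invr_ge0 ltW.
    by rewrite lef_pV2// posrE !mulr_gt0.
  by field; rewrite !gt_eqF.
rewrite -ler_pdivrMl ?exprn_gt0//.
rewrite (_ : w ^- 2 * (E / U) = (w^-1 * (k * E)) / (w * (k * U))).
  apply: ler_pM => //; first by rewrite !mulr_ge0// ltW.
    by rewrite invr_ge0 !mulr_ge0// ltW.
  by rewrite lef_pV2// posrE !mulr_gt0.
by field; rewrite !gt_eqF.
Qed.

Lemma measurable_inv_comp {d} {T : measurableType d} {R : realType}
    (f : T -> R) : (forall x, 0 <= f x) -> measurable_fun setT f ->
  measurable_fun setT (fun x => (f x)^-1).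
Proof.
move=> f0 mf; under eq_fun do rewrite -powR_inv1//.
by apply: (@measurableT_comp _ _ _ _ _ _ (fun y : R => y `^ (- 1))) => //;
  exact: measurable_powR.
Qed.

Lemma measurable_sqrt_comp {d} {T : measurableType d} {R : realType}
    (f : T -> R) : measurable_fun setT f ->
  measurable_fun setT (fun x => Num.sqrt (f x)).
Proof.
move=> mf; apply: measurableT_comp => //.
by apply: continuous_measurable_fun; exact: sqrt_continuous.
Qed.

Lemma measurable_ratio_event {d} {T : measurableType d} {R : realType}
    (f g : T -> R) (c k w : R) : 0 <= c ->
  measurable_fun setT f -> measurable_fun setT g -> (forall x, 0 <= g x) ->
  measurable [set x | w^-1 * Num.sqrt ((c * f x) / (c * g x)) <= k
                        <= w * Num.sqrt ((c * f x) / (c * g x))].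
Proof.
move=> c0 mf mg g0; set h := fun x => Num.sqrt ((c * f x) / (c * g x)).
have mh : measurable_fun setT h.
  apply: measurable_sqrt_comp; apply: measurable_funM.
    exact: measurable_funM.
  apply: measurable_inv_comp; first by move=> x; rewrite mulr_ge0.
  exact: measurable_funM.
rewrite (_ : [set x | _] =
    [set x | w^-1 * h x <= k] `&` [set x | k <= w * h x]).
  by apply: measurableI; apply: measurable_set_le => //; exact: measurable_funM.
by apply/seteqP; split=> x /andP.
Qed.

(** After taking logarithms the claim is the sample size condition, because
    [ln (w / expR 1) = ln w - 1] is positive. *)
Lemma card_expR_sample_size_le {R : realType} (n : nat) (k delta w : R) :
  (0 < n)%N -> 0 < delta -> expR 1 < w ->
  (2 * ln (2 * n%:R) + 2 * ln delta^-1) / ln (w / expR 1) <= k ->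
  (2 * n)%:R * expR (k / 2 * (1 - ln w)) <= delta.
Proof.
move=> n0 d0 ew; have w0 : 0 < w by apply: lt_trans ew; exact: expR_gt0.
have n2 : 0 < 2 * n%:R :> R by rewrite mulr_gt0// ltr0n.
have lnw : 1 < ln w by rewrite -ltr_expR lnK.
rewrite ln_div ?posrE ?expR_gt0// expRK ler_pdivrMr ?subr_gt0// lnV ?posrE//.
move=> H; rewrite natrM.
rewrite -[2 * n%:R in leLHS]lnK ?posrE// -[leRHS]lnK ?posrE//.
by rewrite -expRD ler_expR; lra.
Qed.

(** * Union bound and the two estimates *)

Theorem corollary3p5
  (R : realType) (d : measure_display) (T : measurableType d)
  (P : probability T R)
  (N p K : nat) (Ps : 'I_p -> {fset R}) (HPs : (0 < #|param Ps|)%N)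
  (A : param Ps -> 'M[R]_N) (f u ut : param Ps -> 'cV[R]_N)
  (HA : forall mu, A mu \in unitmx)
  (Hu : forall mu, A mu *m u mu = f mu)
  (Hut : separated_form ut)
  (S : 'M[R]_N) (HS : sym_psd S)
  (Hu0 : forall mu, seminorm_mx S (u mu) != 0)
  (Z : 'I_K -> {RV P >-> N.-tuple R})
  (HZind : mutually_independent Z)
  (HZgauss : forall i, gaussian_vector (Z i))
  (HZmean : forall i, has_mean (Z i) 0)
  (HZcov : forall i, has_covariance (Z i) S)
  (Y : 'I_K -> param Ps -> T -> 'cV[R]_N)
  (HY : forall i mu om, (A mu)^T *m Y i mu om = colv (Z i om))
  (delta w : R) (Hdelta : 0 < delta < 1) (Hw : expR 1 < w)
  (HK : Num.max
          ((2 * ln (2 * #|param Ps|%:R) + 2 * ln delta^-1) / ln (w / expR 1)) 3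
        <= K%:R) :
  let r : param Ps -> 'cV[R]_N := fun mu => f mu - A mu *m ut mu in
  ((1 - delta)%:E <=
     P [set om | forall mu : param Ps,
          (w^-1 * rel_est Y r f mu om
            <= seminorm_mx S (u mu - ut mu) / seminorm_mx S (u mu)
            <= w * rel_est Y r f mu om)%R])%E
  /\
  ((1 - delta)%:E <=
     P [set om |
          (w^-1 * rel_est_global Y r f om
            <= Num.sqrt (#|param Ps|%:R^-1
                         * \sum_mu seminorm_mx S (u mu - ut mu) ^+ 2)
               / Num.sqrt (#|param Ps|%:R^-1
                           * \sum_mu seminorm_mx S (u mu) ^+ 2)
            <= w * rel_est_global Y r f om)%R])%E.
Proof.
move=> r; have /andP[d0 d1] := Hdelta.
have /andP[Ksize K3] : ((2 * ln (2 * #|param Ps|%:R) + 2 * ln delta^-1)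
    / ln (w / expR 1) <= K%:R) && (3 <= K%:R :> R) by rewrite -ge_max.
have w0 : 0 < w by apply: lt_trans Hw; exact: expR_gt0.
have K0 : 0 < K%:R :> R by apply: lt_le_trans K3.
have n0 : 0 < #|param Ps|%:R :> R by rewrite ltr0n.
have psd v : 0 <= dotv v (S *m v) by case: HS.
have normE v : seminorm_mx S v ^+ 2 = dotv v (S *m v) by rewrite sqr_sqrtr.
(* Duality removes [A] and [Y]: the residual is [A mu] applied to the error and [f mu] is [A mu]
   applied to the solution. *)
have dualE i mu om x : dotv (Y i mu om) (A mu *m x) = dotv x (colv (Z i om)).
  rewrite -(HY i mu om) /dotv.
  transitivity (((Y i mu om)^T *m (A mu *m x))^T ord0 ord0).
    by rewrite [RHS]mxE.
  by rewrite !trmx_mul trmxK mulmxA.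
have num mu om : \sum_(i < K) dotv (Y i mu om) (r mu) ^+ 2 =
    sample_sum_sqr Z (u mu - ut mu) om.
  by apply: eq_bigr => i _; rewrite /r -Hu -mulmxBr dualE.
have den mu om : \sum_(i < K) dotv (Y i mu om) (f mu) ^+ 2 =
    sample_sum_sqr Z (u mu) om.
  by apply: eq_bigr => i _; rewrite -Hu dualE.
have ssq0 v om : 0 <= sample_sum_sqr Z v om.
  by apply: sumr_ge0 => i _; exact: sqr_ge0.
have u0 mu : 0 < dotv (u mu) (S *m u mu).
  by rewrite lt_neqAle psd andbT eq_sym -normE sqrf_eq0.
(* The boolean selects solution or error, so the index set has the [2 #P] elements of the union
   bound. *)
pose vec (j : param Ps * bool) := if j.2 then u j.1 else u j.1 - ut j.1.
pose bad := \big[setU/set0]_(j <- enum {: param Ps * bool})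
  ~` concentration_set S Z w (vec j).
have mbad : measurable bad.
  apply: bigsetU_measurable => j _.
  exact/measurableC/measurable_concentration_set.
have Pbad : (P bad <= delta%:E)%E.
  apply: (@le_trans _ _ ((size (enum {: param Ps * bool}))%:R *
      expR (K%:R / 2 * (1 - ln w)))%:E).
    apply: measure_bigsetU_seq_le => j.
      exact/measurableC/measurable_concentration_set.
    exact: probability_concentration_setC.
  rewrite lee_fin -cardE card_prod card_bool mulnC.
  exact: card_expR_sample_size_le.
have good om : (~` bad) om -> forall j, concentration_set S Z w (vec j) om.
  move=> nbad j; apply: contrapT => nj; apply: nbad.
  by rewrite /bad -bigcup_seq; exists j => //=; rewrite mem_enum.
have PE (E : set T) :
    measurable E -> ~` bad `<=` E -> ((1 - delta)%:E <= P E)%E.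
  move=> mE badE; apply: (@le_trans _ _ (P (~` bad))).
    by rewrite probability_setC// EFinB; exact: leeB.
  by apply: le_measure; rewrite ?inE//; exact: measurableC.
split; apply: PE.
- rewrite (_ : [set om | _] = \bigcap_(mu in [set: param Ps]) [set om |
      w^-1 * rel_est Y r f mu om
        <= seminorm_mx S (u mu - ut mu) / seminorm_mx S (u mu)
        <= w * rel_est Y r f mu om]); last first.
    by apply/seteqP; split=> [om H mu _|om H mu]; exact: H.
  apply: fin_bigcap_measurable; first exact: finite_finset.
  move=> mu _; rewrite /rel_est.
  under eq_set do rewrite num den.
  apply: measurable_ratio_event; rewrite ?invr_ge0//.
  - exact: measurable_sample_sum_sqr.
  - exact: measurable_sample_sum_sqr.
- move=> om /good H mu; rewrite /rel_est num den /seminorm_mx.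
  (* For a single parameter the norms carry no averaging factor, hence [c' = 1]. *)
  rewrite -[dotv (u mu - _) _]mul1r -[dotv (u mu) _]mul1r.
  apply: (@ratio_sqrt_bounds _ w _ 1 K%:R) => //; first by rewrite invr_gt0.
  + exact: (H (mu, false)).
  + exact: (H (mu, true)).
- rewrite /rel_est_global.
  under eq_set => om.
    under eq_bigr do rewrite num.
    under [X in _ / (_ * X)]eq_bigr do rewrite den.
    over.
  apply: measurable_ratio_event; rewrite ?invr_ge0//.
  - by apply: measurable_sum => mu; exact: measurable_sample_sum_sqr.
  - by apply: measurable_sum => mu; exact: measurable_sample_sum_sqr.
  - by move=> om; exact: sumr_ge0.
- move=> om /good H; rewrite /= /rel_est_global.
  rewrite (eq_bigr _ (fun mu _ => num mu om)).
  rewrite (eq_bigr _ (fun mu _ => den mu om)).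
  rewrite (eq_bigr _ (fun mu _ => normE (u mu - ut mu))).
  rewrite (eq_bigr _ (fun mu _ => normE (u mu))).
  (* One parameter suffices to make the sum of the [|u(mu)|^2] positive. *)
  have [mu0 _] : exists mu, mu \in [set: param Ps]%SET.
    by apply/card_gt0P; rewrite cardsT.
  apply: (@ratio_sqrt_bounds _ w _ _ K%:R) => //.
  + by rewrite invr_gt0 natrM mulr_gt0.
  + by rewrite invr_gt0.
  + exact: sumr_ge0.
  + by rewrite (bigD1 mu0)//= ltr_pwDl// sumr_ge0.
  + rewrite !mulr_sumr; apply/andP; split; apply: ler_sum => mu _.
      by have /andP[] := H (mu, false).
    by have /andP[] := H (mu, false).
  + rewrite !mulr_sumr; apply/andP; split; apply: ler_sum => mu _.
      by have /andP[] := H (mu, true).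
    by have /andP[] := H (mu, true).
Qed.
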